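(* Let $\epsilon>0$. Then the set $$\left\{m\in\mathbb{Z}^+ \;\middle|\; \text{for all integers } k \text{ with } 0\leq k\leq \frac{\log_2 m}{1-\log_2\sqrt{3}}:\ -\epsilon\log_2 m\leq\sum_{i=0}^{k-1}p(m)_i-\frac{k}{2}\leq \epsilon\log_2 m\right\}$$ is of natural density $1$.
   Context: $\mathbb{Z}^+$ is the set of positive integers. The map $\mathsf{T}:\mathbb{Z}^+\to\mathbb{Z}^+$ is defined by $\mathsf{T}(m)=\frac{m}{2}$ if $m$ is even and $\mathsf{T}(m)=\frac{3m+1}{2}$ if $m$ is odd; $\mathsf{T}^k$ denotes its $k$-fold iterate ($\mathsf{T}^0$ is the identity). The parity sequence $(p(m)_k)_{k\geq 0}$ of $m\in\mathbb{Z}^+$ is defined by $p(m)_k=0$ if $\mathsf{T}^k(m)$ is even and $p(m)_k=1$ if $\mathsf{T}^k(m)$ is odd. A set $A\subseteq\mathbb{Z}^+$ is of natural density $1$ if $\liminf_{n\to\infty}\frac{\#\{m\in A\mid m\leq n\}}{n}=1$. *)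

(* Defs.v *)
From HB Require Import structures.
From mathcomp Require Import all_boot all_order all_algebra.
From mathcomp Require Import all_classical all_reals all_analysis.

Set Implicit Arguments.
Unset Strict Implicit.
Unset Printing Implicit Defensive.

Import Order.TTheory GRing.Theory Num.Theory.
Import numFieldNormedType.Exports.

Local Open Scope classical_set_scope.
Local Open Scope ring_scope.

(* Positive integers are the m : nat with 0 < m; collatz_map preserves them. *)
Definition collatz_map (m : nat) : nat :=
  if odd m then ((3 * m + 1) %/ 2)%N else (m %/ 2)%N.

Definition parity_seq (m k : nat) : nat := odd (iter k collatz_map m).

Definition log2 {R : realType} (x : R) : R := ln x / ln 2.

(* count_upto A n is the number of m in A with 1 <= m <= n. *)
Definition count_upto (A : set nat) (n : nat) : nat :=
  count (fun m => m \in A) (iota 1 n).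

(* The quotient takes values in [0, 1] (at n = 0 it is 0 / 0 = 0), so that the
   real-valued limn_inf is the genuine lower limit. *)
Definition natural_density1 (R : realType) (A : set nat) : Prop :=
  limn_inf (fun n => (count_upto A n)%:R / n%:R : R) = 1.

(* Main.v *)
Require Import Defs.
From HB Require Import structures.
From mathcomp Require Import all_boot all_order all_algebra.
From mathcomp Require Import all_classical all_reals all_analysis.
From mathcomp Require Import ring lra zify.

Import Order.TTheory GRing.Theory Num.Theory.
Import numFieldNormedType.Exports.

Local Open Scope classical_set_scope.
Local Open Scope ring_scope.

(** Write S(m,k) for the number of odd terms among the first k iterates of m.
Among the m < 2^N, the parities of the first N steps behave exactly like N fair
coin tosses, since m mod 2^h decides the first h parities and every pattern
occurs once (sum_odd_steps).  So S(m,k) - k/2 is o(N) for k <= N, outside an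
exponentially small proportion of the m.  The difficulty is that the theorem
asks for about 4.8 N steps, far more than the N bits of information in m.

The argument restarts the coin tossing from T^k(m).  Suppose that m has been
balanced so far, with all deviations at most D.  Then T^k(m) is at most about
2^N (sqrt 3 / 2)^k, up to a factor 3^O(D) (tame_iter_le), and the next h
parities of y = T^k(m) can be unbalanced only for an exponentially small
proportion of the y in that range, as long as 2^h fits into it
(count_unbalanced).  What is needed to conclude is that not too many m are sent
to the same y.  This is count_preimages: at most about (2 / sqrt 3)^k balanced m
have T^k(m) = y, up to a factor k 3^O(D).  Its reason is the formula
2^L T^L(x) = 3^S(x,L) x + offset, applied to x = T^(k-L)(m).  Given m mod
2^(k-L), the value of x is known modulo 3^S(m,k-L); given y and S(x,L) as well,
the offset is therefore known modulo 3^S(m,k).  For a balanced m the offset is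
about 2^L, so it is known exactly when L is chosen with 2^L a little below
3^(k/2), and then m is known.  Hence m is determined by its residue modulo
2^(k-L) and by S(m,k).

The number of possible y times the number of preimages of each is 2^N, up to
k 3^O(D).  So the proportion of m that are balanced up to time k and fail in the
next h steps is at most 3^O(D) exp(-c N), up to a power of N (count_block).  If
D is a sufficiently small multiple of N, the exponential wins.  Cutting the time interval into boundedly many blocks of
length about N / J, with deviations allowed to grow from block to block, gives
control up to the time when (sqrt 3 / 2)^k 2^N falls below 2^(N/J)
(unbalanced_rare_blocks); the remaining O(N / J) steps change S(m,k) - k/2 by
O(N / J) whatever they are (unbalanced_rare). *)

(** * Parities, residues and the affine form of the iterates *)

Definition odd_steps (m k : nat) : nat := (\sum_(0 <= i < k) parity_seq m i)%N.

Lemma odd_stepsS m k : odd_steps m k.+1 = (odd_steps m k + odd (iter k collatz_map m))%N.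
Proof. by rewrite /odd_steps big_nat_recr. Qed.

Lemma odd_stepsD m k i :
  odd_steps m (k + i) = (odd_steps m k + odd_steps (iter k collatz_map m) i)%N.
Proof.
elim: i => [|i IHi]; first by rewrite addn0 /odd_steps (big_geq (m := 0) (n := 0)) ?addn0.
by rewrite addnS !odd_stepsS IHi addnA -iterD [(i + k)%N]addnC.
Qed.

Lemma leq_odd_steps m k i : (i <= k)%N -> (odd_steps m i <= odd_steps m k)%N.
Proof. by move=> /subnKC <-; rewrite odd_stepsD leq_addr. Qed.

Lemma odd_steps_le m k : (odd_steps m k <= k)%N.
Proof.
elim: k => [|k IHk]; first by rewrite /odd_steps big_geq.
by rewrite odd_stepsS -addn1 leq_add ?leq_b1.
Qed.

(** The integer making iter_affine true: every odd step contributes a power of 2,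
and is multiplied by 3 at each later odd step. *)
Fixpoint path_offset (x j : nat) : nat :=
  if j is i.+1 then
    if odd (iter i collatz_map x) then (3 * path_offset x i + 2 ^ i)%N else path_offset x i
  else 0%N.

Lemma iter_affine x j :
  (2 ^ j * iter j collatz_map x = 3 ^ odd_steps x j * x + path_offset x j)%N.
Proof.
elim: j => [|j IHj]; first by rewrite /odd_steps big_geq //= !mul1n addn0.
rewrite odd_stepsS /= expnS [in LHS]/collatz_map.
set u := iter j _ x in IHj *; case Ho: (odd u).
  have -> : (2 * 2 ^ j * ((3 * u + 1) %/ 2) = 2 ^ j * (3 * u + 1))%N.
    by rewrite [(2 * _)%N]mulnC -mulnA; congr muln; lia.
  by rewrite expnD expn1; nia.
by rewrite addn0 -IHj [(2 * _)%N]mulnC -mulnA; congr muln; lia.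
Qed.

Lemma collatz_map_add2 u w :
  collatz_map (u + w.*2)%N = (collatz_map u + 3 ^ odd u * w)%N.
Proof. by rewrite /collatz_map oddD odd_double addbF; case: odd => /=; lia. Qed.

(** Shifting x by a multiple of 2^j moves the first j iterates by even numbers, so
no parity is affected; the j-th iterate is the first one that can move by an odd
number. *)
Lemma iter_periodic x z j :
  odd_steps (x + 2 ^ j * z)%N j = odd_steps x j /\
  iter j collatz_map (x + 2 ^ j * z)%N
    = (iter j collatz_map x + 3 ^ odd_steps x j * z)%N.
Proof.
elim: j z => [|j IHj] z; first by rewrite /odd_steps !big_geq //= !mul1n.
have -> : (2 ^ j.+1 * z = 2 ^ j * z.*2)%N by rewrite expnS; lia.
have [Hs Hi] := IHj z.*2.
have Ho : odd (iter j collatz_map (x + 2 ^ j * z.*2)%N) = odd (iter j collatz_map x).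
  by rewrite Hi oddD oddM odd_double andbF addbF.
rewrite !odd_stepsS Hs Ho; split=> //.
rewrite /= Hi -doubleMr collatz_map_add2 expnD; nia.
Qed.

Lemma odd_steps_periodic x z j i : (i <= j)%N ->
  odd_steps (x + 2 ^ j * z)%N i = odd_steps x i.
Proof.
move=> /subnKC <-; rewrite expnD -mulnA.
by have [-> _] := iter_periodic x (2 ^ (j - i) * z) i.
Qed.

(** The generating function of a sum of i fair coin tosses.  Of the two lifts y and
y + 2^i of a residue, exactly one has an odd i-th iterate, because these
iterates differ by a power of 3. *)
Lemma sum_odd_steps_period (R : comNzRingType) (a : R) i :
  \sum_(0 <= y < 2 ^ i) a ^+ odd_steps y i = (1 + a) ^+ i.
Proof.
elim: i => [|i IHi]; first by rewrite big_nat1 /odd_steps big_geq.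
have le2 : (2 ^ i <= 2 ^ i.+1)%N by rewrite leq_exp2l.
rewrite (big_cat_nat (leq0n _) le2) /= -{2}[(2 ^ i)%N]add0n big_addn.
have -> : (2 ^ i.+1 - 2 ^ i = 2 ^ i)%N by rewrite expnS; lia.
rewrite -big_split /= exprS -IHi mulr_sumr; apply: eq_bigr => y _.
have [Hs Hi] := iter_periodic y 1 i.
rewrite !muln1 in Hs Hi.
rewrite !odd_stepsS Hs Hi oddD oddX orbT.
by case: odd => /=; rewrite !(addn1, addn0) exprS; ring.
Qed.

Lemma sum_odd_steps (R : comNzRingType) (a : R) q i :
  \sum_(0 <= y < q * 2 ^ i) a ^+ odd_steps y i = q%:R * (1 + a) ^+ i.
Proof.
elim: q => [|q IHq]; first by rewrite mul0n big_geq // mul0r.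
have le2 : (q * 2 ^ i <= q.+1 * 2 ^ i)%N by rewrite leq_mul2r leqnSn orbT.
rewrite (big_cat_nat (leq0n _) le2) /= -{2}[(q * 2 ^ i)%N]add0n big_addn IHq.
have -> : (q.+1 * 2 ^ i - q * 2 ^ i = 2 ^ i)%N by rewrite mulSn addnK.
rewrite -natr1 mulrDl mul1r -sum_odd_steps_period; congr (_ + _).
by apply: eq_bigr => y _; rewrite mulnC odd_steps_periodic.
Qed.

(** * Large deviations of the number of odd steps *)

Local Notation count_below P n := (count P (iota 0 n)).

Lemma count_belowE (R : realType) (P : pred nat) n :
  (count_below P n)%:R = \sum_(0 <= y < n) (P y)%:R :> R.
Proof.
rewrite -sum1_count natr_sum big_mkcond /= /index_iota subn0.
by apply: eq_bigr => y _; case: (P y).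
Qed.

Definition balanced {R : realType} (D : R) (k m : nat) : bool :=
  [forall i : 'I_k.+1, `|(odd_steps m i)%:R - i%:R / 2| <= D].

Lemma balancedP (R : realType) (D : R) k m :
  reflect (forall i, (i <= k)%N -> `|(odd_steps m i)%:R - i%:R / 2| <= D)
          (balanced D k m).
Proof.
apply: (iffP forallP) => H i; last by apply: H; rewrite -ltnS ltn_ord.
by rewrite -ltnS => ik; exact: (H (Ordinal ik)).
Qed.

(** This follows from exp x <= 1 / (1 - x) at l and - l; any constant in place of
the 2 in the exponent would serve. *)
Lemma expR_sym_le (R : realType) (l : R) : l ^+ 2 <= 1 / 2 ->
  expR (- l) + expR l <= 2 * expR (2 * l ^+ 2).
Proof.
move=> l2; have [l_gtN1 l_lt1] : -1 < l /\ l < 1 by split; nra.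
have inv_le (x : R) : x < 1 -> expR x <= (1 - x)^-1.
  move=> x1; rewrite -[expR x]invrK -expRN lef_pV2 ?posrE ?expR_gt0 ?subr_gt0 //.
  exact: expR_ge1Dx.
have := inv_le _ l_lt1; have := inv_le (- l); rewrite opprK => /(_ ltac:(lra)).
have h1 : 1 + 2 * l ^+ 2 <= expR (2 * l ^+ 2) by exact: expR_ge1Dx.
have p1 : (1 + l) != 0 by lra.
have p2 : (1 - l) != 0 by lra.
have e1 : (1 + l)^-1 * (1 + l) = 1 by rewrite mulVf.
have e2 : (1 - l)^-1 * (1 - l) = 1 by rewrite mulVf.
have : (1 + l)^-1 + (1 - l)^-1 <= 2 * (1 + 2 * l ^+ 2); last by lra.
have -> : (1 + l)^-1 + (1 - l)^-1 = 2 / (1 - l ^+ 2).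
  by field; rewrite p1 p2 andbT /=; nra.
by rewrite ler_pdivrMr; nra.
Qed.

Lemma expR_ge1_add (R : realType) (x y : R) : y <= `|x| ->
  1 <= expR (- y) * (expR x + expR (- x)).
Proof.
move=> yx; rewrite mulrDr -!expRD.
have [x0|x0] := lerP 0 x.
  rewrite ger0_norm // in yx.
  by rewrite ler_wpDr ?expR_ge0 // -expR0 ler_expR; lra.
rewrite ltr0_norm // in yx.
by rewrite ler_wpDl ?expR_ge0 // -expR0 ler_expR; lra.
Qed.

(** Chernoff's bound: the indicator of a deviation is dominated by a two-sided
exponential, whose sum over full periods is given by the generating function. *)
Lemma count_deviation_at (R : realType) (l G : R) q i : l ^+ 2 <= 1 / 2 -> 0 <= l ->
  (count_below (fun y => G < `|(odd_steps y i)%:R - i%:R / 2|) (q * 2 ^ i))%:R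
    <= 2 * (q * 2 ^ i)%:R * expR (2 * l ^+ 2 * i%:R - 2 * l * G).
Proof.
move=> l2 l0; rewrite count_belowE.
pose W y : R := expR (- (2 * l * G)) *
  (expR (- l) ^+ i * expR (2 * l) ^+ odd_steps y i
   + expR l ^+ i * expR (- (2 * l)) ^+ odd_steps y i).
apply: (@le_trans _ _ (\sum_(0 <= y < q * 2 ^ i) W y)).
  apply: ler_sum => y _; rewrite /W -!expRM_natl -!expRD.
  have [Gy|_] /= := ltrP; last by rewrite mulr_ge0 ?addr_ge0 ?expR_ge0.
  have := @expR_ge1_add R (2 * l * ((odd_steps y i)%:R - i%:R / 2)) (2 * l * G).
  rewrite normrM ger0_norm ?mulr_ge0 // => /(_ (ler_wpM2l _ (ltW Gy))) H.
  apply: le_trans (H _) _; first by rewrite mulr_ge0.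
  by rewrite le_eqVlt; apply/orP; left; apply/eqP; congr (_ * (expR _ + expR _)); field.
rewrite -mulr_sumr big_split /= -!mulr_sumr !sum_odd_steps.
have -> : expR (- l) ^+ i * (q%:R * (1 + expR (2 * l)) ^+ i)
  + expR l ^+ i * (q%:R * (1 + expR (- (2 * l))) ^+ i)
  = 2 * q%:R * (expR (- l) + expR l) ^+ i.
  rewrite 2!(mulrCA _ q%:R) -!exprMn !mulrDr !mulr1 -!expRD.
  have -> : - l + 2 * l = l by ring.
  have -> : l - 2 * l = - l by ring.
  by rewrite [expR l + _]addrC; ring.
have H : (expR (- l) + expR l) ^+ i <= 2 ^+ i * expR (2 * l ^+ 2 * i%:R).
  rewrite [2 * _ * i%:R]mulrC expRM_natl -exprMn lerXn2r ?nnegrE ?addr_ge0 ?mulr_ge0 ?expR_ge0 //.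
  exact: expR_sym_le.
have -> : 2 * (q * 2 ^ i)%:R * expR (2 * l ^+ 2 * i%:R - 2 * l * G)
  = expR (- (2 * l * G)) * (2 * q%:R * (2 ^+ i * expR (2 * l ^+ 2 * i%:R))).
  by rewrite expRD natrM natrX; ring.
by rewrite !ler_wpM2l ?mulr_ge0 ?expR_ge0.
Qed.

(** Union bound over i <= h; any interval of multiples of 2^h is also one of
multiples of 2^i. *)
Lemma count_unbalanced (R : realType) (l G : R) q h : l ^+ 2 <= 1 / 2 -> 0 <= l ->
  (count_below (fun y => ~~ balanced G h y) (q * 2 ^ h))%:R
    <= 2 * h.+1%:R * (q * 2 ^ h)%:R * expR (2 * l ^+ 2 * h%:R - 2 * l * G).
Proof.
move=> l2 l0.
pose P i y := G < `|(odd_steps y i)%:R - i%:R / 2|.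
apply: (@le_trans _ _ (\sum_(0 <= i < h.+1) (count_below (P i) (q * 2 ^ h))%:R)).
  rewrite count_belowE; under [leRHS]eq_bigr do rewrite count_belowE.
  rewrite exchange_big /=; apply: ler_sum => y _.
  case: (boolP (balanced G h y)) => /= [_|]; first exact: sumr_ge0.
  rewrite negb_forall => /existsP[i]; rewrite -ltNge => iP.
  rewrite big_mkord (bigD1 i) //= /P iP ler_wpDr //; exact: sumr_ge0.
have -> : 2 * h.+1%:R * (q * 2 ^ h)%:R * expR (2 * l ^+ 2 * h%:R - 2 * l * G)
  = \sum_(0 <= i < h.+1) 2 * (q * 2 ^ h)%:R * expR (2 * l ^+ 2 * h%:R - 2 * l * G).
  by rewrite sumr_const_nat subn0 -[RHS]mulr_natr; ring.
rewrite !big_mkord; apply: ler_sum => i _.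
have ih : (i <= h)%N by rewrite -ltnS.
have -> : (q * 2 ^ h = q * 2 ^ (h - i) * 2 ^ i)%N by rewrite -mulnA -expnD subnK.
apply: le_trans (count_deviation_at _ _ _ _ _ l2 l0) _.
rewrite ler_wpM2l ?mulr_ge0 // ler_expR lerD2r ler_wpM2l ?ler_nat //.
by rewrite mulr_ge0 // exprn_ge0.
Qed.

(** * Balanced orbits: offsets, preimages and size *)

Lemma sqrt3_bounds (R : realType) :
  (Num.sqrt 3 : R) ^+ 2 = 3 /\ 1 < (Num.sqrt 3 : R) < 7 / 4.
Proof.
have s2 : (Num.sqrt 3 : R) ^+ 2 = 3 by rewrite sqr_sqrtr.
have s0 := sqrtr_ge0 (3 : R).
by split=> //; apply/andP; split; nra.
Qed.

(** The multiplicative form of balanced, in which the size of 3 ^ odd_steps m i is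
compared with (sqrt 3)^i up to the factor E = 3^D. *)
Definition tame {R : realType} (E : R) (k m : nat) : Prop :=
  forall i, (i <= k)%N ->
    Num.sqrt 3 ^+ i <= E * 3 ^+ odd_steps m i /\
    3 ^+ odd_steps m i <= E * Num.sqrt 3 ^+ i.

Lemma balanced_tame (R : realType) (D : R) k m :
  balanced D k m -> tame (expR (D * ln 3)) k m.
Proof.
move=> /balancedP bal i ik; have := bal i ik; rewrite ler_norml => /andP[H1 H2].
have ln3 : 0 <= ln (3 : R) by apply: ln_ge0; lra.
have e3 : expR (ln 3) = 3 :> R by rewrite lnK // posrE.
have -> : Num.sqrt 3 = expR (ln 3 / 2) :> R.
  have e32 : expR (ln 3 / 2) ^+ 2 = 3 :> R by rewrite expr2 -expRD -splitr.
  by rewrite -[in LHS]e32 sqrtr_sqr ger0_norm ?expR_ge0.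
have e3n n : 3 ^+ n = expR (n%:R * ln 3) :> R by rewrite expRM_natl e3.
rewrite !e3n -!expRM_natl -!expRD !ler_expR.
have := ler_wpM2r ln3 H1; have := ler_wpM2r ln3 H2; rewrite !mulrBl mulNr.
by split; lra.
Qed.

(** If the odd steps after each time j are at most about half of the steps, the
contribution of step j to the offset is at most C 2^j (sqrt 3)^(L-j-1), and these
terms form a geometric series of ratio 2 / sqrt 3, hence of size C 2^L. *)
Lemma path_offset_le (R : realType) (C : R) x L : 0 <= C ->
  (forall j, (j <= L)%N ->
    3 ^+ (odd_steps x L - odd_steps x j) <= C * Num.sqrt 3 ^+ (L - j)) ->
  (path_offset x L)%:R * (2 - Num.sqrt 3) <= C * (2 ^+ L - Num.sqrt 3 ^+ L).
Proof.
move=> C0 H; set r := Num.sqrt 3.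
have [r2 /andP[r1 r74]] := sqrt3_bounds R; rewrite -/r in r2 r1 r74.
(* The sum of the first j terms of the series, times 2 - sqrt 3, telescopes. *)
suff : forall j, (j <= L)%N ->
    (path_offset x j)%:R * 3 ^+ (odd_steps x L - odd_steps x j) * (2 - r)
      <= C * (2 ^+ j * r ^+ (L - j) - r ^+ L).
  by move=> /(_ L (leqnn L)); rewrite !subnn !expr0 !mulr1.
elim=> [|j IHj] jL; first by rewrite !mul0r expr0 mul1r subn0 subrr mulr0.
have {}IHj := IHj (ltnW jL); have Hj := H _ jL.
have rE : r ^+ (L - j) = r * r ^+ (L - j.+1) by rewrite -exprS; congr (_ ^+ _); lia.
have := @leq_odd_steps x L j.+1 jL.
have r0 : 0 <= r ^+ (L - j.+1) by rewrite exprn_ge0 // ltW // (lt_trans _ r1).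
rewrite rE in IHj; move: Hj; rewrite odd_stepsS -/r /=.
have t0 : 0 <= 2 ^+ j :> R by rewrite exprn_ge0.
case: odd => /= Hj sL.
  have e : (odd_steps x L - odd_steps x j = (odd_steps x L - (odd_steps x j + 1)).+1)%N by lia.
  rewrite e !exprS in IHj; rewrite natrD natrM natrX exprS.
  move: Hj IHj; set a := 3 ^+ _; set p := _%:R; set u := r ^+ (L - _); set v := r ^+ L.
  set w := 2 ^+ j => Hj IHj.
  have : w * (2 - r) * a <= w * (2 - r) * (C * u) by rewrite ler_wpM2l // mulr_ge0 //; lra.
  have -> : (3 * p + w) * a * (2 - r) = p * (3 * a) * (2 - r) + w * (2 - r) * a by ring.
  have -> : C * (2 * w * u - v) = C * (w * (r * u) - v) + w * (2 - r) * (C * u) by ring.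
  lra.
rewrite addn0 exprS; apply: le_trans IHj _; rewrite ler_wpM2l // lerD2r mulrA ler_wpM2r //.
by rewrite mulrC ler_wpM2r //; lra.
Qed.

(** On a segment of a tame orbit the counts at both ends cost a factor E each. *)
Lemma tame_path_offset_le (R : realType) (E : R) k L m : 0 < E -> tame E k m -> (L <= k)%N ->
  (path_offset (iter (k - L) collatz_map m) L)%:R * (2 - Num.sqrt 3)
    <= E ^+ 2 * (2 ^+ L - Num.sqrt 3 ^+ L).
Proof.
move=> E0 tm Lk.
have [r2 /andP[r1 r74]] := sqrt3_bounds R.
set r := Num.sqrt 3 in r2 r1 r74 *.
have rp n : 0 < r ^+ n by rewrite exprn_gt0 // (lt_trans _ r1).
set x := iter _ _ m.
have Sx j : odd_steps m (k - L + j) = (odd_steps m (k - L) + odd_steps x j)%N by exact: odd_stepsD.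
apply: path_offset_le; rewrite ?exprn_ge0 ?ltW // => j jL.
have -> : (odd_steps x L - odd_steps x j = odd_steps m k - odd_steps m (k - L + j))%N.
  by rewrite Sx -[in odd_steps m k](subnK Lk) Sx subnDl.
have le_jk : (k - L + j <= k)%N by lia.
have [_ ub] := tm k (leqnn k); have [lb _] := tm _ le_jk.
rewrite -/r in ub lb *; have := @leq_odd_steps m _ _ le_jk => Sle.
have p3 : 0 < 3 ^+ odd_steps m (k - L + j) :> R by rewrite exprn_gt0.
rewrite -(ler_pM2r p3) -exprD subnK //; apply: le_trans ub _.
have -> : r ^+ k = r ^+ (L - j) * r ^+ (k - L + j) by rewrite -exprD; congr (_ ^+ _); lia.
rewrite mulrA; set t := 3 ^+ odd_steps _ _ in lb *.
have -> : E ^+ 2 * r ^+ (L - j) * t = E * r ^+ (L - j) * (E * t) by ring.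
by rewrite ler_wpM2l // mulr_ge0 ?ltW.
Qed.

(** For this range of L the offset is determined by its residue modulo
3 ^ odd_steps m k.  The alternative L = 0, where the offset is 0, covers the k
that are too small for the inequality to have any solution. *)
Lemma path_offset_lt (R : realType) (E : R) k L m : 0 < E -> tame E k m -> (L <= k)%N ->
  L = 0%N \/ 4 * E ^+ 3 * 2 ^+ L <= Num.sqrt 3 ^+ k ->
  (path_offset (iter (k - L) collatz_map m) L < 3 ^ odd_steps m k)%N.
Proof.
move=> E0 tm Lk [-> /=|HL]; first by rewrite expn_gt0.
have := @tame_path_offset_le R E k L m E0 tm Lk.
have [r2 /andP[r1 r74]] := sqrt3_bounds R.
set r := Num.sqrt 3 in HL r2 r1 r74 * => off_le.
rewrite -(ltr_nat R) natrX.
have [lb _] := tm k (leqnn k); rewrite -/r in lb.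
rewrite -(ltr_pM2l E0); apply: lt_le_trans lb; apply: lt_le_trans HL.
have -> : 4 * E ^+ 3 * 2 ^+ L = E * (4 * E ^+ 2 * 2 ^+ L) by ring.
rewrite ltr_pM2l //; move: off_le; set p := _%:R => off_le.
have p0 : 0 <= p by exact: ler0n.
have : 0 < E ^+ 2 * r ^+ L by rewrite mulr_gt0 ?exprn_gt0 //; lra.
have : 0 <= p * (7 / 4 - r) by rewrite mulr_ge0 //; lra.
rewrite mulrBr in off_le; lra.
Qed.

(** Two such m differ by 2^(k-L) z, so their iterates at time k - L differ by
3^S z with S the common number of odd steps up to then.  Since the last L steps
lead both to the same point, the two offsets of these steps differ by
3 ^ odd_steps m k * z, which is impossible for z > 0 as both are smaller than
that power. *)
Lemma tame_path_inj (R : realType) (E : R) k L m m' : 0 < E ->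
  tame E k m -> tame E k m' -> (L <= k)%N ->
  L = 0%N \/ 4 * E ^+ 3 * 2 ^+ L <= Num.sqrt 3 ^+ k ->
  m = m' %[mod 2 ^ (k - L)] ->
  odd_steps m k = odd_steps m' k ->
  iter k collatz_map m = iter k collatz_map m' -> m = m'.
Proof.
move=> E0 tm tm' Lk HL; wlog mm' : m m' tm tm' / (m <= m')%N.
  move=> W e1 e2 e3; have [le|/ltnW le] := leqP m m'; first exact: W.
  by apply/esym; apply: W.
move=> /esym/eqP; rewrite eqn_mod_dvd // => /dvdnP[z m'E] Sk Tk.
have {}m'E : m' = (m + 2 ^ (k - L) * z)%N by rewrite mulnC -m'E subnKC.
have [Sr Tr] := iter_periodic m z (k - L).
rewrite -m'E in Sr Tr.
have Skk n : odd_steps n k = (odd_steps n (k - L) + odd_steps (iter (k - L) collatz_map n) L)%N.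
  by rewrite -odd_stepsD subnK.
have Tkk n : iter k collatz_map n = iter L collatz_map (iter (k - L) collatz_map n).
  by rewrite -iterD subnKC.
have off_lt := @path_offset_lt R E k L m E0 tm Lk HL.
have A := iter_affine (iter (k - L) collatz_map m) L.
have A' := iter_affine (iter (k - L) collatz_map m') L.
have Ss : odd_steps (iter (k - L) collatz_map m') L = odd_steps (iter (k - L) collatz_map m) L.
  by move: Sk; rewrite !Skk Sr; lia.
rewrite -Tkk in A; rewrite -Tkk Ss Tr -Tk A mulnDr mulnA -expnD addnC in A'.
rewrite Skk addnC in off_lt.
have [z0|z0] := posnP z; first by rewrite m'E z0 muln0 addn0.
have : (3 ^ (odd_steps (iter (k - L) collatz_map m) L + odd_steps m (k - L))
   <= 3 ^ (odd_steps (iter (k - L) collatz_map m) L + odd_steps m (k - L)) * z)%N by rewrite leq_pmulr.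
lia.
Qed.

(** The injectivity of tame_path_inj is used with L as large as possible, which
makes 2^(k-L) comparable with (2 / sqrt 3)^k.  The bound does not depend on the
range M. *)
Lemma count_preimages (R : realType) (E : R) k y M (P : pred nat) : 1 <= E ->
  (forall m, P m -> tame E k m /\ iter k collatz_map m = y) ->
  (count_below P M)%:R <= k.+1%:R * (8 * E ^+ 3 * (2 / Num.sqrt 3) ^+ k) :> R.
Proof.
move=> E1 HP; have E0 : 0 < E by lra.
have [r2 /andP[r1 r74]] := sqrt3_bounds R.
set r := Num.sqrt 3 in r2 r1 r74 *.
have rp n : 0 < r ^+ n by rewrite exprn_gt0 // (lt_trans _ r1).
have tp n : 0 < 2 ^+ n :> R by rewrite exprn_gt0.
have E3 : 1 <= E ^+ 3 by rewrite exprn_ege1.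
have r0 : 0 < r by lra.
have [L [Lk HL HL2]] : exists L, [/\ (L <= k)%N,
    L = 0%N \/ 4 * E ^+ 3 * 2 ^+ L <= r ^+ k &
    2 ^+ (k - L) <= 8 * E ^+ 3 * (2 / r) ^+ k].
  pose Q L := (L == 0%N) || (4 * E ^+ 3 * 2 ^+ L <= r ^+ k).
  have Q0 : exists L, Q L by exists 0%N.
  have Qk L : Q L -> (L <= k)%N.
    case/orP => [/eqP->//|QL]; rewrite leqNgt; apply/negP => /ltnW kL.
    have : r ^+ k <= 2 ^+ k by rewrite lerXn2r ?nnegrE //; lra.
    have : 2 ^+ k <= 2 ^+ L :> R by apply: ler_weXn2l => //; lra.
    have := tp L; have : 2 ^+ L <= E ^+ 3 * 2 ^+ L by rewrite ler_peMl // ltW.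
    lra.
  case: (ex_maxnP Q0 Qk) => L QL Lmax; exists L; split; first exact: Qk.
    by case/orP: QL => [/eqP|]; [left|right].
  have : ~~ Q L.+1 by apply/negP => /Lmax; rewrite ltnn.
  rewrite /Q /= -ltNge [2 ^+ L.+1]exprS => HL.
  rewrite expr_div_n [leRHS]mulrA ler_pdivlMr // -(ler_pM2r (tp L)).
  have e2 : 2 ^+ (k - L) * 2 ^+ L = 2 ^+ k :> R by rewrite -exprD subnK ?Qk.
  rewrite mulrAC e2.
  have := ler_wpM2l (ltW (tp k)) (ltW HL).
  by set a := 2 ^+ L; set b := 2 ^+ k; set c := E ^+ 3; set d := r ^+ k; lra.
pose f m := (m %% 2 ^ (k - L), odd_steps m k)%N.
pose s := [seq f m | m <- iota 0 M & P m].
have us : uniq s.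
  rewrite map_inj_in_uniq ?filter_uniq ?iota_uniq //.
  move=> m m'; rewrite !mem_filter => /andP[Pm _] /andP[Pm' _] [e1 e2].
  have [tm Tm] := HP _ Pm; have [tm' Tm'] := HP _ Pm'.
  by apply: (@tame_path_inj R E k L) => //; rewrite Tm Tm'.
have sub : {subset s <= [seq (u, v) | u <- iota 0 (2 ^ (k - L)), v <- iota 0 k.+1]}.
  move=> p /mapP[m _ ->]; apply: allpairs_f; rewrite mem_iota add0n /=.
    by rewrite ltn_pmod ?expn_gt0.
  by rewrite ltnS odd_steps_le.
have := uniq_leq_size us sub; rewrite size_map size_filter size_allpairs !size_iota.
rewrite -(ler_nat R) natrM natrX => /le_trans; apply.
by rewrite mulrC ler_wpM2l.
Qed.

(** In the formula for 2^k T^k(m) the term 3^S m and the offset are at most about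
(sqrt 3)^k 2^N and 2^k; the hypothesis on k says that the first dominates. *)
Lemma tame_iter_le (R : realType) (E : R) N k m : 1 <= E -> tame E k m -> (m <= 2 ^ N)%N ->
  2 ^+ k <= Num.sqrt 3 ^+ k * 2 ^+ N :> R ->
  (iter k collatz_map m)%:R <= 5 * E ^+ 2 * (2 ^+ N * (Num.sqrt 3 / 2) ^+ k).
Proof.
move=> E1 tm mN kN; have E0 : 0 < E by lra.
have [r2 /andP[r1 r74]] := sqrt3_bounds R.
set r := Num.sqrt 3 in kN r2 r1 r74 *.
have rp n : 0 < r ^+ n by rewrite exprn_gt0 // (lt_trans _ r1).
have tp n : 0 < 2 ^+ n :> R by rewrite exprn_gt0.
have := @tame_path_offset_le R E k k m E0 tm (leqnn k).
rewrite subnn /= -/r.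
have := congr1 (fun n => n%:R : R) (iter_affine m k).
have [_ ub] := tm k (leqnn k); rewrite -/r in ub.
have m_le : m%:R <= 2 ^+ N :> R by rewrite -natrX ler_nat.
rewrite natrD !natrM !natrX => /= A off.
rewrite expr_div_n [2 ^+ N * _]mulrA [leRHS]mulrA ler_pdivlMr // [leLHS]mulrC A.
have h1 : 3 ^+ odd_steps m k * m%:R <= (E * r ^+ k) * 2 ^+ N :> R.
  by rewrite ler_pM ?exprn_ge0.
have h2 : (path_offset m k)%:R <= 4 * (E ^+ 2 * 2 ^+ k) :> R.
  move: off; set p := _%:R => off.
  have p0 : 0 <= p by exact: ler0n.
  have : 0 <= E ^+ 2 * r ^+ k by rewrite mulr_ge0 ?exprn_ge0 //; lra.
  have : 0 <= p * (7 / 4 - r) by rewrite mulr_ge0 //; lra.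
  rewrite mulrBr in off; lra.
have h3 : E ^+ 2 * 2 ^+ k <= E ^+ 2 * (r ^+ k * 2 ^+ N) by rewrite ler_pM2l ?exprn_gt0.
have h4 : E * (r ^+ k * 2 ^+ N) <= E ^+ 2 * (r ^+ k * 2 ^+ N).
  by rewrite expr2 ler_pM2r ?mulr_gt0 // ler_peMr //; lra.
have -> : 5 * E ^+ 2 * (2 ^+ N * r ^+ k) = 5 * (E ^+ 2 * (r ^+ k * 2 ^+ N)) by ring.
have e1 : E * r ^+ k * 2 ^+ N = E * (r ^+ k * 2 ^+ N) by ring.
lra.
Qed.

(** * Failing in one block of steps *)

Lemma balanced_le (R : realType) (D D' : R) k m :
  D <= D' -> balanced D k m -> balanced D' k m.
Proof. by move=> DD' /balancedP H; apply/balancedP => i /H /le_trans; apply. Qed.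

Lemma balanced_cat (R : realType) (D G : R) k h m : 0 <= G ->
  balanced D k m -> balanced G h (iter k collatz_map m) -> balanced (D + G) (k + h) m.
Proof.
move=> G0 /balancedP bD /balancedP bG; apply/balancedP => i ikh.
have [ik|ki] := leqP i k; first by apply: le_trans (bD _ ik) _; rewrite lerDl.
have ih : (i - k <= h)%N by lia.
have := lerD (bD _ (leqnn k)) (bG _ ih); apply: le_trans.
rewrite -[in leLHS](subnKC (ltnW ki)) odd_stepsD !natrD.
have := ler_normD ((odd_steps m k)%:R - k%:R / 2)
  ((odd_steps (iter k collatz_map m) (i - k))%:R - (i - k)%:R / 2 : R).
apply: le_trans; rewrite le_eqVlt; apply/orP; left; apply/eqP; congr `|_|; by field.
Qed.

Lemma balanced_half (R : realType) h y : balanced (h%:R / 2 : R) h y.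
Proof.
apply/balancedP => i ih; have Si := odd_steps_le y i.
have Si' : (odd_steps y i)%:R <= i%:R :> R by rewrite ler_nat.
have ih' : i%:R <= h%:R :> R by rewrite ler_nat.
have := ler0n R (odd_steps y i); rewrite ler_norml; lra.
Qed.

Lemma count_below_le_add (R : realType) (P Q S : pred nat) n :
  (forall m, (m < n)%N -> P m -> Q m || S m) ->
  (count_below P n)%:R <= (count_below Q n)%:R + (count_below S n)%:R :> R.
Proof.
move=> H; rewrite !count_belowE -big_split /= !big_mkord; apply: ler_sum => m _.
have := H m (ltn_ord m); case: (P m) => /= [/(_ isT)|_]; last by rewrite addr_ge0.
by case: (Q m) => /= [_|->]; rewrite ?lerDl ?lerDr.
Qed.

(** Counting through a map f whose fibres in P have at most B elements. *)
Lemma count_fibre (R : realType) (P Q : pred nat) (f : nat -> nat) (B : R) M Z :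
  (forall m, (m < M)%N -> P m -> (f m < Z)%N) ->
  (forall y, (count_below (fun m => P m && (f m == y)) M)%:R <= B) ->
  (count_below (fun m => P m && Q (f m)) M)%:R <= B * (count_below Q Z)%:R.
Proof.
move=> fZ fB; rewrite !count_belowE mulr_sumr.
apply: (@le_trans _ _ (\sum_(0 <= y < Z) \sum_(0 <= m < M) (P m && (f m == y))%:R * (Q y)%:R)).
  rewrite exchange_big /= !big_mkord; apply: ler_sum => m _.
  case Pm: (P m) => /=; last by apply: sumr_ge0 => y _; rewrite mul0r.
  rewrite big_mkord (bigD1 (Ordinal (fZ m (ltn_ord m) Pm))) //= eqxx mul1r lerDl.
  by apply: sumr_ge0 => y _; rewrite mulr_ge0.
apply: ler_sum => y _; rewrite -mulr_suml ler_wpM2r //.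
by rewrite -count_belowE.
Qed.

(** The iterates at time k lie below Y, which is rounded up to the multiple
q 2^h <= 2 Y of the period; the number of unbalanced ones is multiplied by the
bound B on the fibres.  In B * Y the powers of 2 / sqrt 3 cancel. *)
Lemma count_block (R : realType) (D G l : R) N k h :
  0 <= D -> 0 <= G -> 0 <= l -> l ^+ 2 <= 1 / 2 ->
  2 ^+ (k + h) <= Num.sqrt 3 ^+ k * 2 ^+ N :> R ->
  (count_below (fun m => balanced D k m && ~~ balanced (D + G) (k + h) m) (2 ^ N))%:R
    <= 160 * k.+1%:R * h.+1%:R * expR (D * ln 3) ^+ 5
       * expR (2 * l ^+ 2 * h%:R - 2 * l * G) * 2 ^+ N.
Proof.
move=> D0 G0 l0 l2 khN; set E := expR (D * ln 3).
have E1 : 1 <= E by rewrite -expR0 ler_expR mulr_ge0 // ln_ge0 //; lra.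
have [r2 /andP[r1 r74]] := sqrt3_bounds R.
set r := Num.sqrt 3 in khN r2 r1 r74.
have rp n : 0 < r ^+ n by rewrite exprn_gt0 // (lt_trans _ r1).
have tp n : 0 < 2 ^+ n :> R by rewrite exprn_gt0.
have kN : 2 ^+ k <= r ^+ k * 2 ^+ N.
  by apply: le_trans khN; apply: ler_weXn2l; [lra|lia].
pose Z := 2 ^+ N * (r / 2) ^+ k : R.
have hZ : 2 ^+ h <= Z.
  by rewrite /Z expr_div_n mulrA ler_pdivlMr // -exprD addnC mulrC mulrC [_ * r ^+ k]mulrC.
pose Y := 5 * E ^+ 2 * Z.
have E2 : 1 <= E ^+ 2 by rewrite exprn_ege1.
have ZY : Z <= Y.
  have := tp h; rewrite /Y => th; have Z0 : 0 < Z by exact: lt_le_trans hZ.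
  by rewrite ler_peMl ?ltW //; lra.
have Y0 : 0 <= Y / 2 ^+ h by rewrite divr_ge0 ?ltW // (lt_le_trans (tp h)) // (le_trans hZ).
pose q := (Num.truncn (Y / 2 ^+ h)).+1.
have qY : Y < (q * 2 ^ h)%:R by rewrite natrM natrX -ltr_pdivrMr // truncnS_gt.
have qY2 : (q * 2 ^ h)%:R <= 2 * Y.
  rewrite natrM natrX /q -[_.+1%:R in leLHS]natr1 mulrDl mul1r [2 * Y]mulr_natl mulr2n lerD ?(le_trans hZ) //.
  by rewrite -ler_pdivlMr // truncn_le.
set X := expR _.
pose B := k.+1%:R * (8 * E ^+ 3 * (2 / r) ^+ k).
apply: (@le_trans _ _ (B * (count_below (fun y => ~~ balanced G h y) (q * 2 ^ h))%:R)).
  apply: le_trans (_ : (count_below (fun m => balanced D k m &&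
      ~~ balanced G h (iter k collatz_map m)) (2 ^ N))%:R <= _).
    rewrite ler_nat; apply: sub_count => m /andP[bD nb] /=; rewrite bD /=.
    by apply: contra nb; apply: balanced_cat.
  apply: (@count_fibre R (balanced D k) (fun y => ~~ balanced G h y) (iter k collatz_map)).
    move=> m mN bD; rewrite -(ltr_nat R); apply: le_lt_trans qY.
    by apply: (@tame_iter_le R E N k m) => //; [exact: balanced_tame|exact: ltnW].
  move=> y; apply: (@count_preimages R E k y) => // m /andP[bD /eqP ->].
  by split=> //; exact: balanced_tame.
have B0 : 0 <= B by rewrite !mulr_ge0 ?exprn_ge0 ?divr_ge0 ?expR_ge0 //; lra.
apply: le_trans (ler_wpM2l B0 (@count_unbalanced R l G q h l2 l0)) _; rewrite -/X.
have -> : 160 * k.+1%:R * h.+1%:R * E ^+ 5 * X * 2 ^+ N = B * (2 * h.+1%:R * (2 * Y) * X).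
  have e : (2 / r) ^+ k * (r / 2) ^+ k = 1.
    by rewrite -exprMn mulrA divfK ?divff ?expr1n //; lra.
  rewrite /B /Y /Z; set u := _ ^+ k in e *; set v := _ ^+ k in e *.
  transitivity (160 * k.+1%:R * h.+1%:R * E ^+ 5 * X * 2 ^+ N * (u * v)); last by ring.
  by rewrite e mulr1.
by rewrite ler_wpM2l // ler_wpM2r ?expR_ge0 // ler_wpM2l ?mulr_ge0.
Qed.

(** * Iterating over blocks *)

Lemma log2_sqrt3 (R : realType) :
  0 < 1 - log2 (Num.sqrt 3 : R) < 1 /\
  forall n, Num.sqrt 3 ^+ n = expR (n%:R * (log2 (Num.sqrt 3) * ln 2)) :> R.
Proof.
have [r2 /andP[r1 r74]] := sqrt3_bounds R.
have ln2 : 0 < ln (2 : R) by rewrite ln_gt0 //; lra.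
split.
  have h0 : 0 < ln (Num.sqrt 3 : R) by exact: ln_gt0.
  have h2 : ln (Num.sqrt 3 : R) < ln 2 by rewrite ltr_ln ?posrE; lra.
  by rewrite subr_gt0 /log2 ltr_pdivrMr // mul1r h2 ltrBlDr ltrDl divr_gt0.
move=> n; rewrite /log2 divfK ?gt_eqF // expRM_natl lnK // posrE; lra.
Qed.

(** Each step uses up 1 - log2 (sqrt 3) bits of the size of the iterate: after j
blocks of length h, the orbits still have at least h bits. *)
Lemma block_fits (R : realType) J j h N :
  j%:R * (1 - log2 (Num.sqrt 3)) + 1 <= J%:R :> R -> (J * h <= N)%N ->
  2 ^+ (j * h + h) <= Num.sqrt 3 ^+ (j * h) * 2 ^+ N :> R.
Proof.
move=> jJ JhN; have [_ ->] := log2_sqrt3 R.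
have e2 n : 2 ^+ n = expR (n%:R * ln 2) :> R by rewrite expRM_natl lnK // posrE.
rewrite (e2 (j * h + h)%N) (e2 N) -expRD ler_expR mulrA -mulrDl.
rewrite ler_wpM2r ?ln_ge0 //; first by lra.
have : (J * h)%:R <= N%:R :> R by rewrite ler_nat.
have := ler_wpM2r (ler0n R h) jJ.
rewrite !natrD !natrM; lra.
Qed.

Lemma natr_le_expR (R : realType) (c : R) N : 0 < c ->
  N.+1%:R <= (1 + c^-1) * expR (c * N%:R).
Proof.
move=> c0; have ci : 0 < c^-1 by rewrite invr_gt0.
have cc : c^-1 * c = 1 by rewrite mulVf ?gt_eqF.
have := ler_wpM2l (ltW ci) (@expR_ge1Dx R (c * N%:R)).
rewrite mulrDr mulr1 mulrA cc mul1r mulrDl mul1r -natr1.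
have : 1 <= expR (c * N%:R) by rewrite -expR0 ler_expR mulr_ge0 // ltW.
lra.
Qed.

(** To allow a deviation d N after one more block, only a deviation d' N with d' of
order d^2 may be tolerated before it: the loss exp (5 d' N ln 3) must be beaten
by the gain exp (- d^2 N / 8) of the large deviation bound. *)
Lemma unbalanced_rare_blocks (R : realType) J j : (0 < J)%N ->
  (forall i, (i < j)%N -> i%:R * (1 - log2 (Num.sqrt 3)) + 1 <= J%:R :> R) ->
  forall d : R, 0 < d <= 1 -> exists C c : R, [/\ 0 <= C, 0 < c & forall N,
    (count_below (fun m => ~~ balanced (d * N%:R) (j * (N %/ J)) m) (2 ^ N))%:R
      <= C * expR (- (c * N%:R)) * 2 ^+ N].
Proof.
have mulS_le (k a b : nat) : (a <= b)%N -> ((k * a).+1 <= k.+1 * b.+1)%N.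
  by move=> /(leq_mul (leqnn k)); lia.
move=> J0; elim: j => [|j IHj] Hj d /andP[d0 d1].
  exists 0, 1; split=> // N; rewrite mul0n !mul0r.
  rewrite (@eq_in_count _ _ pred0) ?count_pred0 // => m _ /=.
  apply/negbTE; rewrite negbK; apply/balancedP => i; rewrite leqn0 => /eqP ->.
  by rewrite /odd_steps big_geq // mul0r subrr normr0 mulr_ge0 // ltW.
pose d' := d ^+ 2 / 160.
have d'0 : 0 < d' by rewrite divr_gt0 ?exprn_gt0.
have d'd : d' <= d / 2 by rewrite /d'; nra.
have d'1 : 0 < d' <= 1 by rewrite d'0 /=; lra.
have [C [c [C0 c0 HC]]] := IHj (fun i ij => Hj i (leqW ij)) d' d'1.
(* The loss exp (10 d' N) = exp (4 b N) leaves exp (- 4 b N) of the gain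
   exp (- 8 b N); half of this absorbs the factor quadratic in N. *)
pose b := d ^+ 2 / 64.
have b0 : 0 < b by rewrite divr_gt0 ?exprn_gt0.
pose C1 : R := 160 * j.+1%:R * (1 + b^-1) ^+ 2.
have C10 : 0 <= C1 by rewrite !mulr_ge0 ?exprn_ge0 // addr_ge0 ?invr_ge0 ?ltW.
exists (C + C1), (Num.min c (2 * b)); split=> [||N]; first exact: addr_ge0.
  by rewrite lt_min c0 mulr_gt0.
set h := (N %/ J)%N.
have hN : (h <= N)%N by exact: leq_div.
have JhN : (J * h <= N)%N by rewrite mulnC leq_trunc_div.
have hN' : h%:R <= N%:R :> R by rewrite ler_nat.
have N0 : 0 <= N%:R :> R by [].
pose G := d / 2 * N%:R.
have G0 : 0 <= G by rewrite mulr_ge0 //; lra.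
have D0 : 0 <= d' * N%:R by rewrite mulr_ge0 // ltW.
have blk : (count_below (fun m => balanced (d' * N%:R) (j * h) m &&
     ~~ balanced (d' * N%:R + G) (j * h + h) m) (2 ^ N))%:R
   <= C1 * expR (- (2 * b * N%:R)) * 2 ^+ N.
  have l0 : 0 <= d / 4 by lra.
  have l2 : (d / 4) ^+ 2 <= 1 / 2 by nra.
  have fits := @block_fits R J j h N (Hj j (ltnSn j)) JhN.
  apply: le_trans (@count_block R _ _ _ N (j * h) h D0 G0 l0 l2 fits) _.
  rewrite ler_wpM2r ?exprn_ge0 //.
  have p1 : (j * h).+1%:R <= j.+1%:R * N.+1%:R :> R by rewrite -natrM ler_nat mulS_le.
  have p2 : h.+1%:R <= N.+1%:R :> R by rewrite ler_nat.
  have p3 := @natr_le_expR R b N b0.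
  have ln30 : 0 <= ln (3 : R) by apply: ln_ge0; lra.
  have ln32 : ln (3 : R) <= 2.
    rewrite -[leRHS]expRK ler_ln ?posrE ?expR_gt0 //.
    by have := @expR_ge1Dx R 2; lra.
  rewrite -expRM_natl; set X1 := expR (5 * _); set X2 := expR (2 * _ * _ - _).
  have X12 : X1 * X2 <= expR (- (2 * b * N%:R)) / expR (b * N%:R) ^+ 2.
    rewrite -expRM_natl -expRN -!expRD ler_expR.
    have t1 := ler_wpM2l D0 ln32.
    have t2 := ler_wpM2l (sqr_ge0 d) hN'.
    rewrite /G /b; rewrite /d' in t1 *; lra.
  have e0 : 0 < expR (b * N%:R) by exact: expR_gt0.
  have kh : (j * h).+1%:R * h.+1%:R <= j.+1%:R * ((1 + b^-1) * expR (b * N%:R)) ^+ 2.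
    rewrite expr2 mulrA ler_pM ?mulr_ge0 //; last exact: le_trans p3.
    by apply: le_trans p1 _; rewrite ler_wpM2l.
  have X120 : 0 <= X1 * X2 by rewrite mulr_ge0 ?expR_ge0.
  have := ler_wpM2l (ler0n R 160) (ler_pM (mulr_ge0 (ler0n _ _) (ler0n _ _)) X120 kh X12).
  rewrite !mulrA => /le_trans; apply; rewrite le_eqVlt; apply/orP; left; apply/eqP.
  by rewrite /C1; field; rewrite !gt_eqF.
have := @count_below_le_add R (fun m => ~~ balanced (d * N%:R) (j.+1 * h) m)
  (fun m => ~~ balanced (d' * N%:R) (j * h) m)
  (fun m => balanced (d' * N%:R) (j * h) m && ~~ balanced (d' * N%:R + G) (j * h + h) m) (2 ^ N).
move=> /(_ _)/le_trans; apply.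
  move=> m _; case: (balanced (d' * N%:R) _ _) => //=.
  rewrite mulSn addnC; apply: contra; apply: balanced_le.
  by rewrite /G -mulrDl ler_wpM2r //; lra.
rewrite mulrDl mulrDl lerD //; [apply: le_trans (HC N) _|apply: le_trans blk _];
  rewrite ler_wpM2r ?exprn_ge0 // ler_wpM2l // ler_expR lerN2 ler_wpM2r // ge_min lexx ?orbT //.
Qed.

(** * Logarithmic time and natural density *)

Lemma balanced_extend (R : realType) (D : R) k k' m : balanced D k m ->
  balanced (D + (k' - k)%:R / 2) k' m.
Proof.
move=> bD; apply: (@balanced_le R (D + (k' - k)%:R / 2) _ k' m) => //.
have := @balanced_cat R D _ k (k' - k) m _ bD (balanced_half R (k' - k) _).
rewrite divr_ge0 // => /(_ isT)/balancedP H; apply/balancedP => i ik'.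
by apply: H; lia.
Qed.

(** With J blocks per N steps, the number j of usable blocks is about
(J - 1) / (1 - log2 (sqrt 3)); the time left after them is at most
(N / J + J) / (1 - log2 (sqrt 3)), and is absorbed by eps N / 2 for J and N large. *)
Lemma unbalanced_rare (R : realType) (eps : R) : 0 < eps ->
  exists (C c : R) (N0 : nat), [/\ 0 <= C, 0 < c & forall N, (N0 <= N)%N ->
    (count_below (fun m => ~~ balanced (eps * N%:R)
        (Num.truncn (N%:R / (1 - log2 (Num.sqrt 3)) : R)) m) (2 ^ N))%:R
      <= C * expR (- (c * N%:R)) * 2 ^+ N].
Proof.
move=> e0; have [/andP[kap0 kap1] _] := log2_sqrt3 R.
set kap := 1 - log2 (Num.sqrt 3) in kap0 kap1 *.
pose A := kap^-1; have A0 : 0 < A by rewrite invr_gt0.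
have kA : kap * A = 1 by rewrite divff // gt_eqF.
pose J' := Num.truncn (2 * A / eps); pose J := J'.+1.
have HJ : 2 * A < J%:R * eps by rewrite -ltr_pdivrMr // truncnS_gt.
pose j := (Num.truncn (J'%:R * A)).+1.
have jA : J'%:R * A < j%:R by exact: truncnS_gt.
have Hj i : (i < j)%N -> i%:R * kap + 1 <= J%:R :> R.
  rewrite ltnS truncn_ge_nat ?mulr_ge0 ?(ltW A0) // => iJ.
  have := ler_wpM2r (ltW kap0) iJ; rewrite -mulrA [A * _]mulrC kA mulr1 -[J%:R]natr1; lra.
pose d := Num.min 1 (eps / 4).
have d0 : 0 < d <= 1 by rewrite lt_min ltr01 divr_gt0 //= ge_min lexx.
have de : d <= eps / 4 by rewrite ge_min lexx orbT.
have [C [c [C0 c0 HC]]] := @unbalanced_rare_blocks R J j (ltn0Sn _) Hj d d0.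
exists C, c, (Num.truncn (2 * A * J%:R / eps)).+1; split=> // N NN0.
apply: le_trans (HC N); rewrite ler_nat; apply: sub_count => m /=; apply: contra.
set k := (j * (N %/ J))%N; set k' := Num.truncn _ => bk.
apply: balanced_le (@balanced_extend R _ k k' m bk).
have HN : 2 * A * J%:R < eps * N%:R.
  rewrite [eps * _]mulrC -ltr_pdivrMr //; apply: lt_le_trans (truncnS_gt _) _.
  by rewrite ler_nat.
have k'A : k'%:R <= A * N%:R by rewrite mulrC truncn_le divr_ge0 // ltW.
have [k'k|/ltnW kk'] := leqP k' k.
  rewrite (eqP k'k) mul0r addr0 ler_wpM2r //; lra.
rewrite natrB //.
set h := (N %/ J)%N in k bk kk' *.
have hJ : (J * h)%:R <= N%:R :> R by rewrite ler_nat mulnC leq_trunc_div.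
have Jh : N%:R <= (J * h)%:R + J%:R :> R.
  by rewrite -natrD ler_nat {1}(divn_eq N J) mulnC leq_add2l ltnW // ltn_pmod.
have h0 : 0 <= h%:R :> R by [].
have k_ge : J'%:R * A * h%:R <= k%:R by rewrite natrM ler_wpM2r // ltW.
have k_ge2 : A * N%:R - A * h%:R - A * J%:R <= k%:R.
  apply: le_trans k_ge.
  have := ler_wpM2l (ltW A0) Jh; rewrite natrM -[J%:R]natr1; lra.
have Ah : 2 * A * h%:R <= eps * N%:R.
  have := ler_wpM2r h0 (ltW HJ); have := ler_wpM2l (ltW e0) hJ; rewrite natrM; lra.
have := ler_wpM2r (ler0n R N) de; have := mulr_ge0 (ltW e0) (ler0n R N); lra.
Qed.

Lemma log2X (R : realType) n : log2 (2 ^+ n : R) = n%:R.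
Proof.
have ln2 : 0 < ln (2 : R) by rewrite ln_gt0 //; lra.
by rewrite /log2 lnXn // -[ln 2 *+ n]mulr_natl mulfK // gt_eqF.
Qed.

Lemma le_log2 (R : realType) (x y : R) : 0 < x -> x <= y -> log2 x <= log2 y.
Proof.
move=> x0 xy; have ln2 : 0 < ln (2 : R) by rewrite ln_gt0 //; lra.
by rewrite /log2 ler_pM2r ?invr_gt0 // ler_ln ?posrE // (lt_le_trans x0).
Qed.

(** Density 1 can be tested on dyadic ranges: for 2^(N-1) <= n < 2^N the exceptions
below 2^N are a proportion O(1/N) of n, as are the m below about sqrt n. *)
Lemma natural_density1_dyadic (R : realType) (A : set nat) (P : nat -> pred nat)
    (C c : R) N0 : 0 <= C -> 0 < c ->
  (forall N, (N0 <= N)%N ->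
    (count_below (P N) (2 ^ N))%:R <= C * expR (- (c * N%:R)) * 2 ^+ N) ->
  (forall N m, (0 < m < 2 ^ N)%N -> m \notin A ->
    (m < 2 ^ (N./2).+1)%N || P N m) ->
  natural_density1 R A.
Proof.
move=> C0 c0 HC badA.
pose K := 8 + 2 * C / c.
have K0 : 0 <= K by rewrite addr_ge0 // divr_ge0 ?mulr_ge0 // ltW.
have main n : (0 < n)%N -> (N0 <= trunc_log 2 n)%N ->
    1 - K / (trunc_log 2 n).+1%:R <= (count_upto A n)%:R / n%:R :> R.
  move=> n0; have /andP[] := @trunc_log_bounds 2 n isT n0.
  set N := (trunc_log 2 n).+1 => Nn nN /leqW N0N.
  have np : 0 < n%:R :> R by rewrite ltr0n.
  have cnt : (n <= count_upto A n + (2 ^ (N./2).+1 + count_below (P N) (2 ^ N)))%N.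
    rewrite -[n in (n <= _)%N](size_iota 1 n) -(count_predC (fun m => m \in A)) leq_add2l.
    apply: leq_trans (_ : count (predU (fun m => m < 2 ^ (N./2).+1)%N (P N)) (iota 1 n) <= _)%N.
      rewrite -!size_filter uniq_leq_size ?filter_uniq ?iota_uniq // => m.
      rewrite !mem_filter mem_iota => /andP[/= mA /andP[m0 mn]].
      by rewrite m0 mn !andbT; apply: badA => //; rewrite m0 /=; lia.
    have sub Q M : (n < M)%N -> (count Q (iota 1 n) <= count_below Q M)%N.
      move=> nM; rewrite -!size_filter uniq_leq_size ?filter_uniq ?iota_uniq // => m.
      rewrite !mem_filter !mem_iota => /andP[-> /andP[m0 mn]] /=; lia.
    have := count_predUI (fun m => m < 2 ^ (N./2).+1)%N (P N) (iota 1 n).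
    have := sub (P N) _ nN.
    have : (count (fun m => m < 2 ^ (N./2).+1)%N (iota 1 n) <= 2 ^ (N./2).+1)%N.
      rewrite -size_filter -[leqRHS](size_iota 0) uniq_leq_size ?filter_uniq ?iota_uniq // => m.
      by rewrite mem_filter !mem_iota => /andP[].
    lia.
  have N1 : 0 < N%:R :> R by rewrite ltr0n.
  have n2 : 2 ^+ N <= 2 * n%:R :> R by rewrite -natrX -natrM ler_nat expnS leq_mul2l.
  have small : (2 ^ (N./2).+1)%:R * N%:R <= 8 * n%:R :> R.
    have N_le : (N <= 2 * 2 ^ (N - N./2))%N.
      by have := @ltn_expl 2 (N - N./2) isT; lia.
    have N_split : (2 ^ N./2 * 2 ^ (N - N./2) = 2 ^ N)%N by rewrite -expnD; congr expn; lia.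
    have := leq_mul (leqnn (2 ^ N./2)) N_le.
    rewrite mulnCA N_split => le2.
    apply: (@le_trans _ _ (4 * 2 ^+ N)); last by lra.
    by rewrite -natrX -!natrM ler_nat expnS; lia.
  have rare : (count_below (P N) (2 ^ N))%:R * N%:R <= 2 * C / c * n%:R :> R.
    have := HC N N0N => h.
    have ec : expR (- (c * N%:R)) * (c * N%:R) <= 1.
      rewrite expRN mulrC ler_pdivrMr ?expR_gt0 // mul1r.
      by have := @expR_ge1Dx R (c * N%:R); lra.
    apply: le_trans (ler_wpM2r (ler0n R N) h) _.
    have eN : expR (- (c * N%:R)) * N%:R <= c^-1.
      by rewrite -[leRHS]mul1r ler_pdivlMr // -mulrA [N%:R * c]mulrC.
    have -> : C * expR (- (c * N%:R)) * 2 ^+ N * N%:R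
      = C * 2 ^+ N * (expR (- (c * N%:R)) * N%:R) by ring.
    have -> : 2 * C / c * n%:R = C * (2 * n%:R) * c^-1 by ring.
    rewrite ler_pM ?mulr_ge0 ?exprn_ge0 ?expR_ge0 //.
    exact: ler_wpM2l.
  rewrite ler_pdivlMr //.
  move: cnt; rewrite -(ler_nat R) !natrD => cnt.
  suff : (2 ^ (N./2).+1)%:R + (count_below (P N) (2 ^ N))%:R <= K / N%:R * n%:R :> R by lra.
  rewrite mulrAC ler_pdivlMr // /K; lra.
rewrite /natural_density1.
have cv : (fun n => (count_upto A n)%:R / n%:R : R) @ \oo --> (1 : R).
  apply/cvgrPdist_le => e e_gt0; near=> n.
  have n0 : (0 < n)%N by near: n; exists 1%N.
  have n1 : (maxn N0 (Num.truncn (K / e)) <= trunc_log 2 n)%N.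
    near: n; exists (2 ^ maxn N0 (Num.truncn (K / e)))%N => // n /= hn.
    exact: trunc_log_max.
  move: n1; rewrite geq_max => /andP[nN0 nK].
  have lb := main n n0 nN0.
  have ub : (count_upto A n)%:R / n%:R <= 1 :> R.
    rewrite ler_pdivrMr ?ltr0n // mul1r ler_nat /count_upto.
    by rewrite -[leqRHS](size_iota 1 n) count_size.
  rewrite ger0_norm ?subr_ge0 // lerBlDr -lerBlDl; apply: le_trans lb.
  rewrite lerB // ler_pdivrMr ?ltr0n // mulrC -ler_pdivrMr //.
  by apply: le_trans (ltW (truncnS_gt _)) _; rewrite ler_nat.
by have [-> _] := cvg_limn_inf_sup cv.
Unshelve. all: by end_near.
Qed.

Theorem theorem1p6 (R : realType) (eps : R) (heps : 0 < eps) :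
  natural_density1 R
    [set m : nat | (0 < m)%N /\
      forall k : nat,
        k%:R <= log2 (m%:R : R) / (1 - log2 (Num.sqrt 3 : R)) ->
        - eps * log2 (m%:R : R)
          <= (\sum_(0 <= i < k) parity_seq m i)%:R - k%:R / 2
          <= eps * log2 (m%:R : R)].
Proof.
set A := [set m | _].
have [/andP[kap0 _] _] := log2_sqrt3 R.
have e2 : 0 < eps / 2 by lra.
have [C [c [N0 [C0 c0 HC]]]] := @unbalanced_rare R (eps / 2) e2.
pose P N m := ~~ balanced (eps / 2 * N%:R)
  (Num.truncn (N%:R / (1 - log2 (Num.sqrt 3)) : R)) m.
apply: (@natural_density1_dyadic R A P C c N0) => // N m.
move=> /andP[m0 mN]; apply: contraR; rewrite negb_or -leqNgt negbK => /andP[mN2 /balancedP bal].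
(* As m is not small, log2 m lies between N / 2 and N, which turns bounds in N
   into bounds in log2 m. *)
have lo : N%:R / 2 <= log2 (m%:R : R).
  apply: le_trans (_ : (N./2).+1%:R <= _).
    by rewrite ler_pdivrMr // -natrM ler_nat; lia.
  by rewrite -(log2X R (N./2).+1) le_log2 ?exprn_gt0 // -natrX ler_nat.
have hi : log2 (m%:R : R) <= N%:R.
  by rewrite -(log2X R N) le_log2 ?ltr0n // -natrX ler_nat ltnW.
rewrite inE; split=> // k kle.
have kN : (k <= Num.truncn (N%:R / (1 - log2 (Num.sqrt 3 : R))))%N.
  rewrite truncn_ge_nat ?divr_ge0 ?(ltW kap0) //; apply: le_trans kle _.
  by rewrite ler_pM2r ?invr_gt0.
have := bal k kN; rewrite -/(odd_steps m k) ler_norml.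
have := ler_wpM2l (ltW heps) lo; lra.
Qed.
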